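(* \[m_{\mathbb{H}}(x^2-y^2)=0.\]
   Context: $\mathbb{H}$ denotes the quaternions, $\mathbb{T}^2(\mathbb{H})=\{(x,y)\in\mathbb{H}^2:|x|=|y|=1\}$ with probability Haar measure $\mu$, and $m_{\mathbb{H}}(P)=\int_{\mathbb{T}^2(\mathbb{H})}\log|P(x,y)|\,d\mu$. *)

(* Defs.v *)
From HB Require Import structures.
From mathcomp Require Import all_boot all_order all_algebra.
From mathcomp Require Import all_classical all_reals all_analysis.
Set Implicit Arguments. Unset Strict Implicit. Unset Printing Implicit Defensive.
Import Order.TTheory GRing.Theory Num.Theory.
Local Open Scope classical_set_scope.
Local Open Scope ring_scope.

(* Quaternions a + b i + c j + d k, represented as ((a, b), c), d) in R^4,
   with the product measurable structure (= Borel structure of R^4). *)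
Notation quat R := (R * R * R * R)%type.

Section Quat.
Variable R : realType.

Definition qre (q : quat R) : R := q.1.1.1.
Definition qi  (q : quat R) : R := q.1.1.2.
Definition qj  (q : quat R) : R := q.1.2.
Definition qk  (q : quat R) : R := q.2.

Definition mkquat (a b c d : R) : quat R := (a, b, c, d).

Definition qmul (p q : quat R) : quat R :=
  mkquat
    (qre p * qre q - qi p * qi q - qj p * qj q - qk p * qk q)
    (qre p * qi q + qi p * qre q + qj p * qk q - qk p * qj q)
    (qre p * qj q - qi p * qk q + qj p * qre q + qk p * qi q)
    (qre p * qk q + qi p * qj q - qj p * qi q + qk p * qre q).

Definition qsub (p q : quat R) : quat R :=
  mkquat (qre p - qre q) (qi p - qi q) (qj p - qj q) (qk p - qk q).

Definition qnorm (q : quat R) : R :=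
  Num.sqrt (qre q ^+ 2 + qi q ^+ 2 + qj q ^+ 2 + qk q ^+ 2).

Definition torusH2 : set ((quat R * quat R)%type) :=
  [set z | qnorm z.1 = 1 /\ qnorm z.2 = 1].

Definition ltransl (g z : (quat R * quat R)%type) : (quat R * quat R)%type :=
  (qmul g.1 z.1, qmul g.2 z.2).

(* mu is the (probability) Haar measure of the compact group T^2(H):
   a Borel probability measure on H^2 concentrated on T^2(H) and invariant
   under left translations by elements of T^2(H).  (Such a measure exists and
   is unique.) *)
Definition is_Haar_torusH2 (mu : probability ((quat R * quat R)%type) R) : Prop :=
  mu (~` torusH2) = 0%E /\
  forall g, torusH2 g ->
    forall A, measurable A -> mu (ltransl g @^-1` A) = mu A.

Definition mahlerH (mu : probability ((quat R * quat R)%type) R)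
    (P : quat R -> quat R -> quat R) : \bar R :=
  (\int[mu]_(z in torusH2) (ln (qnorm (P z.1 z.2)))%:E)%E.

End Quat.

(* Main.v *)
Require Import Defs.
From HB Require Import structures.
From mathcomp Require Import all_boot all_order all_algebra.
From mathcomp Require Import all_classical all_reals all_analysis.
From mathcomp Require Import measurable_realfun ring lra zify.

Set Implicit Arguments. Unset Strict Implicit. Unset Printing Implicit Defensive.
Import Order.TTheory GRing.Theory Num.Theory numFieldNormedType.Exports.
Local Open Scope classical_set_scope.
Local Open Scope ring_scope.

(** Write [x = y w]: the law of [(y w, y)] is again Haar, and [x^2 - y^2] has norm
    [|Im w| |u y + y u|] with [u = Im w / |Im w|], that is
    [2 |Im w| sqrt ((Re y)^2 + <u, y>^2)].  Conjugation invariance replaces [u] by [i],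
    so the Mahler measure is
    [ln 2 + E ln |Im w| + E ln sqrt ((Re y)^2 + (qi y)^2)].
    Expanding [- ln (1 - t)] into its power series reduces both expectations to moments,
    which rotation invariance determines recursively:
    [E (Re w)^(2n) = prod_(j < n) (2j + 1) / (2j + 4)] and
    [E ((Re y)^2 + (qi y)^2)^n = 1 / (n + 1)].
    The resulting series sum to [1/2 - ln 2] and [- 1/2]. *)

(** * The logarithm as a power series *)

Section RealSeries.
Variable R : realType.
Implicit Types (x t : R) (n k N K : nat).

(** The Haar measure is known only through its invariance, so every value has to come from
    translations and Tonelli. Tonelli asks for nonnegative integrands, while the logarithm is
    singular on [x^2 = y^2] and its integrability is not known beforehand. The work is therefore
    done with [mlog], which is [- ln] with values in [[0, +oo]], applied to [|x^2 - y^2|^2 / 4]. The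
    divisor 4 brings the argument into [[0, 1]], where the expansion has nonnegative terms and can
    be integrated term by term; the square turns those terms into polynomials in the coordinates,
    within reach of rotation invariance. The Mahler measure is [ln 2] minus half the integral of
    [mlog], and that integral is [(2 ln 2 - 1) + 1]. Its finiteness is what shows, at the very end,
    that the singular set is null. *)

Lemma is_derive_log_remainder N (y : R) : y < 1 ->
  is_derive y (1:R) (fun z : R => - ln (1 - z) - \sum_(0 <= n < N) z ^+ n.+1 / n.+1%:R)
    (y ^+ N / (1 - y)).
Proof.
move=> y1.
elim: N => [|N IH].
  have -> : (fun z : R => - ln (1 - z) - \sum_(0 <= n < 0) z ^+ n.+1 / n.+1%:R)
     = (fun z : R => - ln (1 - z)).
    by apply/funext => z; rewrite big_geq// subr0.
  have Hl : is_derive (1 - y) 1 (@ln R) (1 - y)^-1 by apply: is_derive1_ln; rewrite subr_gt0.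
  have H1 : is_derive y (1:R) (fun z : R => 1 - z) (-1).
    by apply: is_derive_eq; rewrite add0r mul1r.
  have H2 := @is_derive1_comp R (@ln R) (fun z : R => 1 - z) y _ _ Hl H1.
  apply: (is_derive_eq (is_deriveN H2)).
  by rewrite expr0 div1r mulrN1 opprK.
have -> : (fun z : R => - ln (1 - z) - \sum_(0 <= n < N.+1) z ^+ n.+1 / n.+1%:R)
   = (fun z : R => - ln (1 - z) - \sum_(0 <= n < N) z ^+ n.+1 / n.+1%:R)
     \- (fun z : R => N.+1%:R^-1 *: z ^+ N.+1).
  apply/funext => z /=; rewrite big_nat_recr//= opprD addrA.
  by rewrite [X in _ - X]mulrC.
have H2 : is_derive y (1:R) (fun z : R => N.+1%:R^-1 *: z ^+ N.+1) (y ^+ N).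
  have H3 := @is_deriveX R R^o id N.+1 y 1 _ (is_derive_id y 1).
  rewrite (_ : (fun z : R => _) = N.+1%:R^-1 \*: ((id : R -> R^o) ^+ N.+1)); last first.
    by apply/funext => z; rewrite exprfctE.
  apply: (is_derive_eq (is_deriveZ N.+1%:R^-1 H3)).
  by rewrite /GRing.scale/= mulr1 mulrA mulVf ?mul1r// pnatr_eq0.
apply: (@is_derive_eq _ _ _ _ _ _ _ _ (is_deriveB IH H2)).
have : 1 - y != 0 by rewrite subr_eq0; apply/eqP => h; rewrite -h ltxx in y1.
by move=> h; rewrite exprS; field.
Qed.

(** The remainder vanishes at 0, so by the mean value theorem it equals [x * c ^+ N / (1 - c)] for
    some [c] between 0 and [x], and [z ^+ N / (1 - z)] is nonnegative and increasing. *)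
Lemma log_remainder_bounds N (x : R) : 0 <= x < 1 ->
  0 <= - ln (1 - x) - \sum_(0 <= n < N) x ^+ n.+1 / n.+1%:R <= x ^+ N / (1 - x).
Proof.
move=> /andP[]; rewrite le_eqVlt => /predU1P[<- _|x0 x1].
  rewrite subr0 ln1 oppr0 big1 ?subr0 ?lexx/= ?invr1 ?mulr1 ?exprn_ge0//.
  by move=> i _; rewrite exprS !mul0r.
pose g (z : R) := - ln (1 - z) - \sum_(0 <= n < N) z ^+ n.+1 / n.+1%:R.
have D (z : R) : z < 1 -> is_derive z (1:R) g (z ^+ N / (1 - z)).
  exact: is_derive_log_remainder.
have [| |c /[!in_itv]/= /andP[c0 cx]] := @MVT R g (fun z => z ^+ N / (1 - z)) 0 x x0.
- by move=> z; rewrite in_itv/= => /andP[_ zx]; apply: D; exact: lt_trans x1.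
- apply: derivable_within_continuous => z; rewrite in_itv/= => /andP[_ zx].
  have H := D z (le_lt_trans zx x1); exact: ex_derive.
have g0 : g 0 = 0.
  by rewrite /g subr0 ln1 oppr0 big1 ?subr0// => i _; rewrite exprS !mul0r.
rewrite g0 !subr0 -/(g x) => ->.
have c1 : 0 < 1 - c by rewrite subr_gt0 (lt_trans cx).
have x1' : 0 < 1 - x by rewrite subr_gt0.
apply/andP; split.
  by rewrite !mulr_ge0 ?invr_ge0 ?exprn_ge0// ltW.
apply: (@le_trans _ _ (c ^+ N / (1 - c))).
  by rewrite ler_piMr ?divr_ge0 ?exprn_ge0 ?ltW.
rewrite ler_pM ?exprn_ge0 ?invr_ge0 ?(ltW c0) ?(ltW c1)//.
  by rewrite lerXn2r ?nnegrE ?(ltW c0) ?(ltW x0) ?(ltW cx).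
by rewrite lef_pV2 ?posrE// lerB// ltW.
Qed.

Lemma cvg_nneseries (u : nat -> R) (l : R) : (forall n, 0 <= u n) ->
  (fun N => \sum_(0 <= n < N) u n) @ \oo --> l ->
  (\sum_(0 <= n <oo) (u n)%:E = l%:E)%E.
Proof.
move=> u0 ul; apply/cvg_lim => //.
rewrite (_ : (fun n => _) = EFin \o (fun N => \sum_(0 <= n < N) u n)).
  by apply: cvg_EFin; [exact: nearW|exact: ul].
by apply/funext => n /=; rewrite sumEFin.
Qed.

(* [- ln t] on the interval (0, 1] and [+oo] at [0], so that [mlogM] holds at [0] too;
   the absolute value makes every term nonnegative on the whole line. *)
Definition mlog (t : R) : \bar R :=
  (\sum_(0 <= n <oo) (`|1 - t| ^+ n.+1 / n.+1%:R)%:E)%E.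

Lemma mlog_ge0 t : (0 <= mlog t)%E.
Proof. by apply: nneseries_ge0 => n _ _; rewrite lee_fin divr_ge0. Qed.

Lemma mlogE t : 0 < t <= 1 -> mlog t = (- ln t)%:E.
Proof.
move=> /andP[t0 t1].
have x0 : 0 <= 1 - t by rewrite subr_ge0.
have x1 : 1 - t < 1 by lra.
rewrite /mlog; apply: cvg_nneseries => [n|]; first by rewrite divr_ge0.
rewrite ger0_norm//.
have xN : (fun N => - ln t - (1 - t) ^+ N / t) @ \oo --> - ln t.
  rewrite -[X in _ --> X]subr0; apply: cvgB; first exact: cvg_cst.
  rewrite -[X in _ --> X](mul0r t^-1); apply: cvgM; last exact: cvg_cst.
  by apply: cvg_expr; rewrite ger0_norm.
apply: (squeeze_cvgr _ xN (cvg_cst (- ln t))).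
apply: nearW => N.
have := @log_remainder_bounds N (1 - t); rewrite x0 x1 => /(_ isT).
rewrite (_ : 1 - (1 - t) = t); last by lra.
by move=> /andP[h1 h2]; apply/andP; split; lra.
Qed.

(** At 0 the series is the harmonic one; a finite value would bound its partial sums. *)
Lemma mlog0 : mlog 0 = +oo%E.
Proof.
have [//|h] := eqVneq (mlog 0) +oo%E.
exfalso; apply: (@dvg_harmonic R).
have fin : mlog 0 \is a fin_num by rewrite ge0_fin_numE ?mlog_ge0// ltey.
apply: nondecreasing_is_cvgn.
  by apply: nondecreasing_series => n _ _; exact: harmonic_ge0.
exists (fine (mlog 0)) => _ [n _ <-].
rewrite -lee_fin fineK// /series/= -sumEFin.
apply: (@le_trans _ _ (\sum_(0 <= k < n) (`|1 - 0| ^+ k.+1 / k.+1%:R)%:E)%E).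
  by apply: lee_sum => k _; rewrite lee_fin subr0 normr1 expr1n mul1r.
by apply: nneseries_lim_ge => k _ _; rewrite lee_fin divr_ge0.
Qed.

Lemma mlogM s t : 0 <= s <= 1 -> 0 <= t <= 1 ->
  mlog (s * t) = (mlog s + mlog t)%E.
Proof.
move=> /andP[]; rewrite le_eqVlt => /predU1P[<- _ _|s0 s1].
  by rewrite mul0r mlog0 addye// gt_eqF// (lt_le_trans _ (mlog_ge0 t)).
move=> /andP[]; rewrite le_eqVlt => /predU1P[<- _|t0 t1].
  by rewrite mulr0 mlog0 addey// gt_eqF// (lt_le_trans _ (mlog_ge0 s)).
rewrite !mlogE ?s0 ?t0// ?mulr_gt0//=; last by rewrite mulr_ile1// ltW.
by rewrite lnM ?posrE// opprD EFinD.
Qed.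

Lemma measurable_mlog : measurable_fun setT (fun t : R => mlog t).
Proof.
apply: ge0_emeasurable_sum => [n x _ _|n _]; first by rewrite lee_fin divr_ge0.
apply/measurable_EFinP/measurable_funM => //.
apply: measurable_funX; apply: measurableT_comp => //.
exact: measurable_funB.
Qed.

End RealSeries.

(** * A telescoping evaluation of the moment series *)

Section WZ.
Variable R : realType.
Implicit Types (n k N K : nat).

(* [wz n 1] is the moment of order [2n] of a coordinate on the 3-sphere, [wz n 0] the
   one on the circle; shifting [k] makes the series of [wz n k / n] telescope. *)
Definition wz n k : R :=
  \prod_(0 <= j < n) ((j.*2.+1)%:R / (k + j.+1).*2%:R).

Lemma wz0 k : wz 0 k = 1. Proof. by rewrite /wz big_geq. Qed.

Lemma wzS n k : wz n.+1 k = wz n k * ((n.*2.+1)%:R / (k + n.+1).*2%:R).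
Proof. by rewrite /wz big_nat_recr. Qed.

Lemma wz_ge0 n k : 0 <= wz n k.
Proof. by rewrite /wz prodr_ge0// => j _; rewrite divr_ge0. Qed.

Lemma natr_double n : (n.*2)%:R = 2 * n%:R :> R.
Proof. by rewrite -muln2 natrM mulrC. Qed.

(** The denominator of [wz n k] is [2^n (k+1) ... (k+n)]; raising [k] trades the factor [k+1] for
    [k+n+1]. *)
Lemma wz_shift n k : wz n k.+1 * (k + n.+1)%:R = wz n k * k.+1%:R.
Proof.
elim: n => [|n IH]; first by rewrite !wz0 addn1.
have k0 := ler0n R k; have n0 := ler0n R n.
have h1 : (k + n.+1)%:R != 0 :> R by rewrite pnatr_eq0 addnS.
rewrite !wzS.
have -> : wz n k.+1 = wz n k * k.+1%:R / (k + n.+1)%:R by rewrite -IH mulfK.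
rewrite addSn -[(k + n.+1).+1]addnS.
rewrite (natr_double (k + _)) (natr_double (k + _)).
by field; apply/andP; split; apply: lt0r_neq0; lra.
Qed.

(** A Wilf-Zeilberger pair: a difference in [k] of the summand is a difference in [n], so its sum
    over [n] leaves only boundary terms. *)
Lemma wz_diff n k : wz n.+1 k / n.+1%:R - wz n.+1 k.+1 / n.+1%:R
  = (wz n.+1 k - wz n.+2 k) * (2 / k.*2.+1%:R).
Proof.
have k0 := ler0n R k; have n0 := ler0n R n.
have -> : wz n.+1 k.+1 = wz n.+1 k * k.+1%:R / (k + n.+2)%:R.
  by rewrite -wz_shift mulfK// pnatr_eq0 addnS.
rewrite (wzS n.+1) natr_double.
rewrite -[(n.+1).*2.+1]addn1 -[k.*2.+1]addn1 !natrD !natr_double.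
by field; rewrite !lt0r_neq0//; lra.
Qed.

Lemma wz_partial_diff N k :
  \sum_(0 <= n < N) wz n.+1 k / n.+1%:R - \sum_(0 <= n < N) wz n.+1 k.+1 / n.+1%:R
  = (1 / k.+1.*2%:R - wz N.+1 k) * (2 / k.*2.+1%:R).
Proof.
elim: N => [|N IH].
  rewrite !big_geq// wzS wz0 addn1 subrr.
  by rewrite mul1r div1r subrr mul0r.
rewrite !big_nat_recr//= opprD addrACA IH wz_diff; ring.
Qed.

(** Each factor [(2j+1)/(2j+4)] is at most [(j+1)/(j+2)], and the product of these telescopes. *)
Lemma wz1_le n : wz n 1 <= n.+1%:R^-1.
Proof.
elim: n => [|n IH]; first by rewrite wz0 invr1.
rewrite wzS.
apply: (@le_trans _ _ (n.+1%:R^-1 * (n.+1.*2%:R / (1 + n.+1).*2%:R))).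
  rewrite ler_pM ?wz_ge0 ?divr_ge0// ler_pM2r ?invr_gt0 ?ltr0n ?double_gt0//.
  by rewrite ler_nat doubleS.
rewrite !natr_double add1n.
by rewrite (_ : _ * _ = n.+2%:R^-1)//; have n0 := ler0n R n; field; rewrite !lt0r_neq0//; lra.
Qed.

Lemma wz_leS n k : wz n k.+1 <= wz n k.
Proof.
have h : 0 < (k + n.+1)%:R :> R by rewrite ltr0n addnS.
rewrite -(ler_pM2r h) wz_shift. by rewrite ler_pM ?wz_ge0 ?lexx ?ler_nat// addnS ltnS leq_addr.
Qed.

Lemma wz_le1 n k : wz n k.+1 <= wz n 1.
Proof. elim: k => // k; exact/le_trans/wz_leS. Qed.

(** By [wz_shift] the left side decreases in [k], the order being at least 1. The resulting decay
    like [1/k] makes the remainder in [wzsum_split] vanish. *)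
Lemma wzS_le n k : wz n.+1 k.+1 * k.+2%:R <= wz n.+1 1 * 2.
Proof.
elim: k => // k; apply: le_trans.
by rewrite -(wz_shift n.+1 k.+1) ler_pM ?wz_ge0 ?lexx ?ler_nat//; lia.
Qed.

Lemma sum_inv_mul N : \sum_(0 <= n < N) n.+2%:R^-1 / n.+1%:R = 1 - N.+1%:R^-1 :> R.
Proof.
elim: N => [|N IH]; first by rewrite big_geq// invr1 subrr.
rewrite big_nat_recr//= IH; have N0 := ler0n R N.
by field; rewrite !lt0r_neq0//; lra.
Qed.

Lemma cvg_invS : (fun N => N.+1%:R^-1 : R) @ \oo --> (0 : R).
Proof. exact: cvg_harmonic. Qed.

Lemma cvg_sum_inv_mul :
  (fun N => \sum_(0 <= n < N) n.+2%:R^-1 / n.+1%:R : R) @ \oo --> (1 : R).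
Proof.
rewrite (_ : (fun N => _) = (fun N => 1 - N.+1%:R^-1)); last first.
  by apply/funext => N; exact: sum_inv_mul.
by rewrite -[X in _ --> X]subr0; apply: cvgB; [exact: cvg_cst|exact: cvg_invS].
Qed.

Definition wzsum N k : R := \sum_(0 <= n < N) wz n.+1 k / n.+1%:R.

Lemma wzsum_ge0 N k : 0 <= wzsum N k.
Proof. by apply: sumr_ge0 => n _; rewrite divr_ge0 ?wz_ge0. Qed.

Lemma wzsum1_le N : wzsum N 1 <= 1.
Proof.
apply: (@le_trans _ _ (\sum_(0 <= n < N) n.+2%:R^-1 / n.+1%:R)).
  by apply: ler_sum => n _; rewrite ler_pM2r ?invr_gt0 ?ltr0n// wz1_le.
by rewrite sum_inv_mul gerBl invr_ge0.
Qed.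

Lemma wzsum_tail N k : wzsum N k.+1 <= 2 / k.+2%:R.
Proof.
apply: (@le_trans _ _ (2 / k.+2%:R * wzsum N 1)); last first.
  by rewrite ler_piMr ?wzsum1_le// divr_ge0.
rewrite /wzsum mulr_sumr; apply: ler_sum => n _.
rewrite mulrA ler_pM2r ?invr_gt0 ?ltr0n// mulrAC ler_pdivlMr ?ltr0n//.
by rewrite [2 * _]mulrC wzS_le.
Qed.

(** The boundary terms at [n = 0] left by [wz_partial_diff] at the levels 1 to [K]. *)
Definition wzlim K : R := \sum_(0 <= k < K) (k.+2%:R * k.*2.+3%:R)^-1.

Lemma wzsum_split N K : wzsum N 1 =
  wzlim K - \sum_(0 <= k < K) wz N.+1 k.+1 * (2 / k.*2.+3%:R) + wzsum N K.+1.
Proof.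
elim: K => [|K IH]; first by rewrite /wzlim !big_geq// subrr add0r.
rewrite IH /wzlim !big_nat_recr//=.
rewrite -[wzsum N K.+1](subrK (wzsum N K.+2)) wz_partial_diff.
have K0 := ler0n R K; rewrite !natr_double -[(K.+1).*2.+1]addn1.
rewrite !natrD !natr_double.
by field; rewrite !lt0r_neq0//; lra.
Qed.

Lemma wzsum_bounds N K :
  wzlim K - K%:R / N.+2%:R <= wzsum N 1 <= wzlim K + 2 / K.+2%:R.
Proof.
have h : 0 <= \sum_(0 <= k < K) wz N.+1 k.+1 * (2 / k.*2.+3%:R) <= K%:R / N.+2%:R.
  apply/andP; split.
    by apply: sumr_ge0 => k _; rewrite mulr_ge0 ?wz_ge0 ?divr_ge0.
  have -> : K%:R / N.+2%:R = \sum_(0 <= k < K) N.+2%:R^-1 :> R.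
    by rewrite sumr_const_nat subn0 mulr_natl.
  apply: ler_sum => k _.
  rewrite -[leRHS]mulr1 ler_pM ?wz_ge0 ?divr_ge0//.
    by rewrite (le_trans (wz_le1 _ _))// wz1_le.
  by rewrite ler_pdivrMr ?ltr0n// mul1r ler_nat.
rewrite (wzsum_split N K); move: h => /andP[h0 h1]; apply/andP; split.
  by rewrite -addrA lerD2l -[leLHS]addr0 lerD ?wzsum_ge0// lerN2.
by rewrite lerD ?wzsum_tail// gerBl.
Qed.

(** * Harmonic sums and [ln 2] *)

Definition dsum m : R := \sum_(0 <= i < m) (m + i).+1%:R^-1.

(** Catalan's identity for [H_(2m) - H_m]: passing to [m+1] adds [1/(2m+1) + 1/(2m+2)] and removes
    [1/(m+1)], which is twice the last term. *)
Lemma dsumE m : dsum m = \sum_(0 <= i < m) (i.*2.+1%:R^-1 - i.*2.+2%:R^-1).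
Proof.
elim: m => [|m IH]; first by rewrite /dsum !big_geq.
rewrite big_nat_recr//= -IH.
have e : dsum m + m.*2.+1%:R^-1 + m.*2.+2%:R^-1 = m.+1%:R^-1 + dsum m.+1.
  have := erefl (\sum_(0 <= i < m.+2) (m + i).+1%:R^-1 : R).
  rewrite [in RHS]big_nat_recl// addn0 [in LHS]big_nat_recr//= big_nat_recr//=.
  rewrite addnS addnn -/(dsum m) => ->; congr (_ + _).
  by apply: eq_bigr => i _; rewrite addnS.
have m0 := ler0n R m.
have -> : dsum m.+1 = dsum m + m.*2.+1%:R^-1 + m.*2.+2%:R^-1 - m.+1%:R^-1.
  by rewrite e; ring.
rewrite -addrA -addrA; congr (_ + _).
rewrite -[m.*2.+2]addn2 -[m.*2.+1]addn1 !natrD natr_double.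
by field; rewrite !lt0r_neq0//; lra.
Qed.

(** Both sides come from [ln (1 + t) <= t], at [t = - 1/(x+1)] and at [t = 1/x]. *)
Lemma ln_step (x : R) : 0 < x -> (x + 1)^-1 <= ln (x + 1) - ln x <= x^-1.
Proof.
move=> x0; have x1 : 0 < x + 1 by lra.
rewrite -ln_div ?posrE//; apply/andP; split.
  have -> : (x + 1) / x = (x / (x + 1))^-1 by rewrite invf_div.
  rewrite lnV ?posrE ?divr_gt0//.
  have -> : x / (x + 1) = 1 + (- (x + 1)^-1) by field; rewrite lt0r_neq0.
  rewrite lerNr; apply: le_ln1Dx; rewrite ltrN2 invf_lt1//; lra.
have -> : (x + 1) / x = 1 + x^-1 by field; rewrite lt0r_neq0.
by apply: le_ln1Dx; rewrite (lt_trans (ltrN10 _))// invr_gt0.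
Qed.

Lemma ln_sum_bounds m j : (0 < m)%N ->
  \sum_(0 <= i < j) (m + i).+1%:R^-1 <= ln (m + j)%:R - ln (m%:R : R)
  <= \sum_(0 <= i < j) (m + i).+1%:R^-1 + m%:R^-1 - (m + j)%:R^-1.
Proof.
move=> m0; elim: j => [|j IH].
  by rewrite big_geq// addn0 subrr add0r subrr lexx.
rewrite big_nat_recr//= addnS.
have := @ln_step (m + j)%:R; rewrite ltr0n addn_gt0 m0 => /(_ isT).
rewrite natr1.
set S := \sum_(0 <= i < j) _ in IH *.
move: IH; move: (ln (m + j).+1%:R) (ln (m + j)%:R) (ln m%:R) => a b c.
move: ((m + j).+1%:R^-1) ((m + j)%:R^-1) (m%:R^-1) S => x y z S.
by move=> /andP[? ?] /andP[? ?]; apply/andP; split; lra.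
Qed.

Lemma dsum_bounds m : (0 < m)%N -> ln 2 - (m.*2)%:R^-1 <= dsum m <= ln 2.
Proof.
move=> m0; have := ln_sum_bounds m m0; rewrite -/(dsum m) addnn natr_double.
have mp : 0 < (m%:R : R) by rewrite ltr0n.
rewrite lnM ?posrE// addrK invfM => /andP[h1 h2]; apply/andP; split; first lra.
exact: h1.
Qed.

(** Partial fractions turn the term into [2/(2k+3) - 2/(2k+4)]; the subtracted 1 is the missing
    first pair [2 (1 - 1/2)]. *)
Lemma wzlimE K : wzlim K = 2 * dsum K.+1 - 1.
Proof.
rewrite dsumE big_nat_recl//= mulrDr mulr_sumr.
rewrite double0 (_ : 2 * _ = 1 :> R); last by field.
rewrite addrC addrA addNr add0r; apply: eq_bigr => k _.
have k0 := ler0n R k.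
rewrite doubleS -[k.*2.+4]addn4 -[k.*2.+3]addn3 !natrD natr_double -[k.+2]addn2 natrD.
by field; rewrite !lt0r_neq0//; lra.
Qed.

Lemma cvg_wzlim : wzlim @ \oo --> 2 * ln 2 - 1.
Proof.
have hl : (fun K => 2 * ln 2 - 1 - K.+1%:R^-1 : R) @ \oo --> 2 * ln 2 - 1.
  by rewrite -[X in _ --> X]subr0; apply: cvgB; [exact: cvg_cst|exact: cvg_invS].
apply: (squeeze_cvgr _ hl (cvg_cst (2 * ln 2 - 1))); apply: nearW => K.
rewrite wzlimE; have := @dsum_bounds K.+1 isT.
rewrite natr_double invfM; move: (dsum _) (K.+1%:R^-1) (ln 2) => x y z.
move=> /andP[? ?]; apply/andP; split; lra.
Qed.

(* [S_N = wzlim K + O(1/K) + O(K/N)]: let first [N], then [K], tend to infinity. *)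
Lemma cvg_wzsum : (fun N => wzsum N 1) @ \oo --> 2 * ln 2 - 1.
Proof.
have nd : nondecreasing_seq (fun N => wzsum N 1).
  by apply: nondecreasing_series => n _ _; rewrite divr_ge0 ?wz_ge0.
have cv : cvgn (fun N => wzsum N 1).
  by apply: nondecreasing_is_cvgn => //; exists 1 => _ [N _ <-]; exact: wzsum1_le.
set l := limn (fun N => wzsum N 1) in cv *.
have lcv : (fun N => wzsum N 1) @ \oo --> l by [].
suff -> : 2 * ln 2 - 1 = l by [].
have inv2 : (fun K => K.+2%:R^-1 : R) @ \oo --> (0 : R).
  by have := cvg_invS; rewrite -(cvg_shiftS (fun N => N.+1%:R^-1 : R)).
apply: (cvg_unique _ cvg_wzlim) => //.
have hl : (fun K => l - 2 * K.+2%:R^-1 : R) @ \oo --> l.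
  rewrite -[X in _ --> X]subr0 -(mulr0 2); apply: cvgB; first exact: cvg_cst.
  by apply: cvgM => //; exact: cvg_cst.
apply: (squeeze_cvgr _ hl (cvg_cst l)); apply: nearW => K; apply/andP; split.
  rewrite lerBlDr; apply: limr_le => //; apply: nearW => N.
  by have /andP[] := wzsum_bounds N K.
have hK : (fun N => wzlim K - K%:R * N.+2%:R^-1 : R) @ \oo --> wzlim K.
  rewrite -[X in _ --> X]subr0 -(mulr0 K%:R); apply: cvgB; first exact: cvg_cst.
  by apply: cvgM => //; exact: cvg_cst.
apply: (ler_cvg_to hK lcv); apply: nearW => N.
by have /andP[] := wzsum_bounds N K.
Qed.

End WZ.

(** * Quaternions *)

Section QuatAlg.
Variable R : realType.
Implicit Types (p q r g h : quat R).

Definition qsq q : R := qre q ^+ 2 + qi q ^+ 2 + qj q ^+ 2 + qk q ^+ 2.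
Definition qconj q : quat R := mkquat (qre q) (- qi q) (- qj q) (- qk q).
Definition S3 : set (quat R) := [set q | qsq q = 1].

Lemma qsqM p q : qsq (qmul p q) = qsq p * qsq q.
Proof.
by case: p q => [[[a b] c] d] [[[x y] z] t]; rewrite /qsq /qmul /mkquat /qre /qi /qj /qk/=; ring.
Qed.

Lemma qsq_conj q : qsq (qconj q) = qsq q.
Proof. by rewrite /qsq /qconj /mkquat /qre /qi /qj /qk/= !sqrrN. Qed.

Lemma qmulA p q r : qmul p (qmul q r) = qmul (qmul p q) r.
Proof.
case: p q r => [[[a b] c] d] [[[x y] z] t] [[[e f] g] h].
by rewrite /qmul /mkquat /qre /qi /qj /qk/=; congr (_, _, _, _); ring.
Qed.

Lemma qconjK q : qconj (qconj q) = q.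
Proof.
by case: q => [[[a b] c] d]; rewrite /qconj /mkquat /qre /qi /qj /qk/= !opprK.
Qed.

Lemma qconjM p q : qconj (qmul p q) = qmul (qconj q) (qconj p).
Proof.
case: p q => [[[a b] c] d] [[[x y] z] t].
by rewrite /qconj /qmul /mkquat /qre /qi /qj /qk/=; congr (_, _, _, _); ring.
Qed.

Lemma S3M p q : S3 p -> S3 q -> S3 (qmul p q).
Proof. by rewrite /S3/= qsqM => -> ->; rewrite mulr1. Qed.

Lemma S3_conj q : S3 q -> S3 (qconj q).
Proof. by rewrite /S3/= qsq_conj. Qed.

Lemma qconj_mul_cancel p q : S3 p -> qmul (qconj p) (qmul p q) = q.
Proof.
rewrite /S3 /qsq/=.
case: p q => [[[a b] c] d] [[[x y] z] t].
rewrite /qconj /qmul /mkquat /qre /qi /qj /qk/= => h; congr (_, _, _, _).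
- by rewrite -[RHS]mul1r -h; ring.
- by rewrite -[RHS]mul1r -h; ring.
- by rewrite -[RHS]mul1r -h; ring.
- by rewrite -[RHS]mul1r -h; ring.
Qed.

Lemma qnorm_sq q : qnorm q ^+ 2 = qsq q.
Proof. by rewrite sqr_sqrtr// !addr_ge0 ?sqr_ge0. Qed.

Lemma qnorm1 q : qnorm q = 1 <-> S3 q.
Proof.
rewrite /S3/= -qnorm_sq; split=> [->|/eqP]; first by rewrite expr1n.
by rewrite sqrp_eq1 ?sqrtr_ge0// => /eqP.
Qed.

(* [|x^2 - y^2|^2 / 4], which lies in [[0, 1]] on the torus. *)
Definition mahler_arg (x y : quat R) : R := qsq (qsub (qmul x x) (qmul y y)) / 4%:R.

Definition sinsq (g : quat R) : R := qi g ^+ 2 + qj g ^+ 2 + qk g ^+ 2.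
(* Squared length of the projection of [h] to the plane spanned by [1] and [u]. *)
Definition linesq (u h : quat R) : R :=
  qre h ^+ 2 + (qi u * qi h + qj u * qj h + qk u * qk h) ^+ 2.
(** The case [u = i] of [linesq]. *)
Definition cosq (h : quat R) : R := qre h ^+ 2 + qi h ^+ 2.

Lemma qmulBr p q r : qmul p (qsub q r) = qsub (qmul p q) (qmul p r).
Proof.
case: p q r => [[[a b] c] d] [[[x y] z] t] [[[e f] g] h].
by rewrite /qmul /qsub /mkquat /qre /qi /qj /qk/=; congr (_, _, _, _); ring.
Qed.

Lemma qmulBl p q r : qmul (qsub p q) r = qsub (qmul p r) (qmul q r).
Proof.
case: p q r => [[[a b] c] d] [[[x y] z] t] [[[e f] g] h].
by rewrite /qmul /qsub /mkquat /qre /qi /qj /qk/=; congr (_, _, _, _); ring.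
Qed.

(* [(hg)^2 - h^2 = h (gh - h (qconj g)) g], and [gh - h (qconj g)] only sees the
   imaginary part of [g]. *)
Lemma mahler_arg_mul g h : S3 g -> S3 h ->
  mahler_arg (qmul h g) h =
  sinsq g * qre h ^+ 2 + (qi g * qi h + qj g * qj h + qk g * qk h) ^+ 2.
Proof.
move=> hg hh; rewrite /mahler_arg.
have -> : qsub (qmul (qmul h g) (qmul h g)) (qmul h h) =
          qmul h (qmul (qsub (qmul g h) (qmul h (qconj g))) g).
  rewrite qmulBl qmulBr; congr qsub; first by rewrite !qmulA.
  congr (qmul h _); rewrite -qmulA.
  have -> : qmul (qconj g) g = mkquat 1 0 0 0.
    have := qconj_mul_cancel (mkquat 1 0 0 0) hg.
    by congr (qmul _ _ = _); case: (g) => [[[a b] c] d];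
      rewrite /qmul /mkquat /qre /qi /qj /qk/=; congr (_, _, _, _); ring.
  by case: (h) => [[[a b] c] d];
      rewrite /qmul /mkquat /qre /qi /qj /qk/=; congr (_, _, _, _); ring.
rewrite !qsqM (_ : qsq h = 1)// (_ : qsq g = 1)// mul1r mulr1.
case: g h {hg hh} => [[[a b] c] d] [[[x y] z] t].
rewrite /sinsq /qsq /qsub /qmul /qconj /mkquat /qre /qi /qj /qk/=.
by field.
Qed.

Lemma mahler_arg_ge0 x y : 0 <= mahler_arg x y.
Proof. by rewrite /mahler_arg divr_ge0// !addr_ge0 ?sqr_ge0. Qed.

(** Parallelogram law: for unit [p] and [q], [|p - q|^2 + |p + q|^2 = 4]. *)
Lemma mahler_arg_le1 x y : S3 x -> S3 y -> mahler_arg x y <= 1.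
Proof.
move=> /[dup] hx /S3M/(_ hx) + /[dup] hy /S3M/(_ hy).
rewrite /mahler_arg /S3/= ler_pdivrMr// mul1r.
case: (qmul x x) (qmul y y) => [[[a b] c] d] [[[p q] r] s].
rewrite /qsq /qsub /mkquat /qre /qi /qj /qk/= => h1 h2.
have : 0 <= (a + p) ^+ 2 + (b + q) ^+ 2 + (c + r) ^+ 2 + (d + s) ^+ 2.
  by rewrite !addr_ge0 ?sqr_ge0.
nra.
Qed.

Lemma linesq_ge0 u h : 0 <= linesq u h.
Proof. by rewrite addr_ge0 ?sqr_ge0. Qed.

(** Cauchy-Schwarz on the imaginary parts, by way of Lagrange's identity. *)
Lemma linesq_le1 u h : sinsq u = 1 -> S3 h -> linesq u h <= 1.
Proof.
rewrite /sinsq /S3 /linesq/= => hu hh; rewrite -[leRHS]hh /qsq -!addrA lerD2l.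
rewrite -[leRHS]mul1r -hu.
have : 0 <= (qi u * qj h - qj u * qi h) ^+ 2 + (qi u * qk h - qk u * qi h) ^+ 2
  + (qj u * qk h - qk u * qj h) ^+ 2 by rewrite !addr_ge0 ?sqr_ge0.
nra.
Qed.

Lemma sinsq_ge0 g : 0 <= sinsq g.
Proof. by rewrite !addr_ge0 ?sqr_ge0. Qed.

Lemma sinsqE g : S3 g -> 1 - sinsq g = qre g ^+ 2.
Proof. by rewrite /S3/= => <-; rewrite /qsq /sinsq; ring. Qed.

Lemma sinsq_le1 g : S3 g -> sinsq g <= 1.
Proof. by move=> /sinsqE h; rewrite -subr_ge0 h sqr_ge0. Qed.

Lemma cosq_ge0 h : 0 <= cosq h.
Proof. by rewrite addr_ge0 ?sqr_ge0. Qed.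

(** The axis [u] is the direction of the imaginary part of [g]; for real [g] both sides vanish and
    [i] serves as the axis. *)
Lemma axis_factor g : exists2 u, sinsq u = 1 & forall h,
  sinsq g * qre h ^+ 2 + (qi g * qi h + qj g * qj h + qk g * qk h) ^+ 2
  = sinsq g * linesq u h.
Proof.
have [g0|g0] := eqVneq (sinsq g) 0.
  exists (mkquat 0 1 0 0).
    by rewrite /sinsq /mkquat /qi /qj /qk/= expr1n expr0n/= !addr0.
  move: g0 => /eqP; rewrite /sinsq !paddr_eq0 ?addr_ge0 ?sqr_ge0// !sqrf_eq0.
  by move=> /andP[/andP[/eqP-> /eqP->] /eqP->] h; ring.
have s0 : 0 < sinsq g by rewrite lt_def g0 sinsq_ge0.
set s := Num.sqrt (sinsq g).
have sE : s ^+ 2 = sinsq g by rewrite sqr_sqrtr ?ltW.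
have s1 : s != 0 by rewrite gt_eqF// sqrtr_gt0.
exists (mkquat 0 (qi g / s) (qj g / s) (qk g / s)).
  rewrite /sinsq /mkquat [qi _]/= [qj _]/= [qk _]/=.
  by rewrite /qi /qj /qk/= !expr_div_n -!mulrDl sE divff.
move=> h; rewrite -sE /linesq /mkquat /qre /qi /qj /qk/=.
by field.
Qed.

(* The half-turn about the bisector of [i] and [u] exchanges [i] and [u]. *)
Lemma axis_conj u : sinsq u = 1 -> exists2 k, S3 k & forall h, S3 h ->
  linesq u (qmul (qconj k) (qmul h k)) = cosq h.
Proof.
move=> hu; have [u1|u1] := eqVneq (qi u) (-1).
  (* For imaginary part [-i] there is no bisector, but [linesq] is even in the imaginary part of
     [u], so the identity rotation works. *)
  exists (mkquat 1 0 0 0).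
    by rewrite /S3 /qsq /mkquat /qre /qi /qj /qk/= expr1n expr0n/= !addr0.
  move=> h _; move: hu; rewrite /sinsq u1 sqrrN expr1n -addrA => /eqP.
  rewrite addrC -subr_eq0 addrK paddr_eq0 ?sqr_ge0// !sqrf_eq0.
  move=> /andP[/eqP hj /eqP hk].
  rewrite /linesq u1 hj hk /cosq; case: h => [[[a b] c] d].
  by rewrite /qmul /qconj /mkquat /qre /qi /qj /qk/=; ring.
have uge : -1 <= qi u.
  have : qi u ^+ 2 <= 1 by rewrite -hu /sinsq -addrA lerDl addr_ge0 ?sqr_ge0.
  by move=> ?; nra.
have N0 : 0 < 2 * (1 + qi u).
  by rewrite mulr_gt0// -ltrBlDl sub0r lt_def u1.
(* [r] normalises [i + Im u], whose squared length is [2 (1 + qi u)]. *)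
set r := (Num.sqrt (2 * (1 + qi u)))^-1.
have rE : r ^+ 2 * (2 * (1 + qi u)) = 1.
  by rewrite exprVn sqr_sqrtr ?ltW// mulVf// gt_eqF.
case: u hu u1 uge N0 @r rE => [[[a b] c] e].
rewrite /sinsq /mkquat /qi /qj /qk/= => hu _ _ _ rE.
set r := (Num.sqrt _)^-1 in rE *.
have kS : r ^+ 2 * ((1 + b) ^+ 2 + c ^+ 2 + e ^+ 2) = 1.
  transitivity (r ^+ 2 * (1 + 2 * b + (b ^+ 2 + c ^+ 2 + e ^+ 2))); first by ring.
  by rewrite hu -[RHS]rE; ring.
exists (mkquat 0 (r * (1 + b)) (r * c) (r * e)).
  by rewrite /S3 /qsq /mkquat /qre /qi /qj /qk/= -[RHS]kS; ring.
case=> [[[x y] z] t] _.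
rewrite /linesq /cosq /qmul /qconj /mkquat /qre /qi /qj /qk/=.
(* For a unit imaginary [k], conjugation sends an imaginary [v] to [2 <k, v> k - v]; the second
   square is the pairing of this image with the imaginary part of [u]. *)
transitivity ((r ^+ 2 * ((1 + b) ^+ 2 + c ^+ 2 + e ^+ 2) * x) ^+ 2 +
  (2 * r ^+ 2 * ((1 + b) * y + c * z + e * t) * (b + (b ^+ 2 + c ^+ 2 + e ^+ 2))
   - r ^+ 2 * ((1 + b) ^+ 2 + c ^+ 2 + e ^+ 2) * (b * y + c * z + e * t)) ^+ 2).
  by ring.
rewrite kS hu !mul1r; congr (_ + _ ^+ 2).
transitivity ((r ^+ 2 * (2 * (1 + b))) * ((1 + b) * y + c * z + e * t)
  - (b * y + c * z + e * t)); first by ring.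
by rewrite rE; ring.
Qed.
End QuatAlg.

(** * Invariant integration on the unit sphere *)

Section Measurability.
Variable R : realType.
Context d (T : measurableType d).
Implicit Types f g : T -> quat R.

Lemma measurable_coords f : measurable_fun setT f ->
  [/\ measurable_fun setT (fun t => qre (f t)), measurable_fun setT (fun t => qi (f t)),
      measurable_fun setT (fun t => qj (f t)) & measurable_fun setT (fun t => qk (f t))].
Proof.
move=> mf; rewrite /qre /qi /qj /qk.
have m1 : measurable_fun setT (fun t => (f t).1) by exact: measurableT_comp.
have m2 : measurable_fun setT (fun t => (f t).1.1) by exact: (measurableT_comp _ m1).
split.
- exact: (measurableT_comp _ m2).
- exact: (measurableT_comp _ m2).
- exact: (measurableT_comp _ m1).
- exact: (measurableT_comp _ mf).
Qed.

Lemma measurable_mkquat (a b c e : T -> R) :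
  measurable_fun setT a -> measurable_fun setT b ->
  measurable_fun setT c -> measurable_fun setT e ->
  measurable_fun setT (fun t => mkquat (a t) (b t) (c t) (e t)).
Proof. by move=> ma mb mc me; do 3 apply: measurable_fun_pair => //. Qed.

Lemma measurable_qmul f g : measurable_fun setT f -> measurable_fun setT g ->
  measurable_fun setT (fun t => qmul (f t) (g t)).
Proof.
move=> /measurable_coords[? ? ? ?] /measurable_coords[? ? ? ?].
by apply: measurable_mkquat; repeat first
  [ assumption | apply: measurable_funB | apply: measurable_funD | apply: measurable_funM].
Qed.

Lemma measurable_qsub f g : measurable_fun setT f -> measurable_fun setT g ->
  measurable_fun setT (fun t => qsub (f t) (g t)).
Proof.
move=> /measurable_coords[? ? ? ?] /measurable_coords[? ? ? ?].
by apply: measurable_mkquat; apply: measurable_funB.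
Qed.

Lemma measurable_qconj f : measurable_fun setT f ->
  measurable_fun setT (fun t => qconj (f t)).
Proof.
move=> /measurable_coords[? ? ? ?].
by apply: measurable_mkquat => //; apply: measurableT_comp.
Qed.

Lemma measurable_qsq f : measurable_fun setT f ->
  measurable_fun setT (fun t => qsq (f t)).
Proof.
move=> /measurable_coords[? ? ? ?].
by repeat apply: measurable_funD; apply: measurable_funX.
Qed.

Lemma measurable_mahler_arg f g : measurable_fun setT f -> measurable_fun setT g ->
  measurable_fun setT (fun t => mahler_arg (f t) (g t)).
Proof.
move=> mf mg; apply: measurable_funM => //; apply: measurable_qsq.
by apply: measurable_qsub; apply: measurable_qmul.
Qed.

End Measurability.

(** * Tonelli up to null sets *)

Section Fubini.
Context d1 d2 (T1 : measurableType d1) (T2 : measurableType d2) (R : realType).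
Variables (m1 : probability T1 R) (m2 : probability T2 R).
Local Open Scope ereal_scope.

Lemma eq_integral_conull d (T : measurableType d) (m : probability T R)
    (D : set T) (f g : T -> \bar R) : measurable D -> m (~` D) = 0 ->
  measurable_fun setT f -> measurable_fun setT g ->
  (forall x, 0 <= f x) -> (forall x, 0 <= g x) ->
  (forall x, D x -> f x = g x) -> \int[m]_x f x = \int[m]_x g x.
Proof.
move=> mD D0 mf mg f0 g0 fg; apply: ge0_ae_eq_integral => //.
exists (~` D); split => //; first exact: measurableC.
by move=> x /= + Dx; apply => _; exact: fg.
Qed.

Lemma integral_conull d (T : measurableType d) (m : probability T R)
    (D : set T) (f : T -> \bar R) : measurable D -> m (~` D) = 0 ->
  measurable_fun setT f -> (forall x, 0 <= f x) ->
  \int[m]_(x in D) f x = \int[m]_x f x.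
Proof.
move=> mD D0 mf f0; rewrite [RHS](@ge0_negligible_integral _ _ _ m setT (~` D))//.
  by rewrite setTD setCK.
exact: measurableC.
Qed.

Lemma probability_conull d (T : measurableType d) (m : probability T R)
    (D : set T) : measurable D -> m (~` D) = 0 -> m D = 1.
Proof.
move=> mD D0.
transitivity (m (D `|` ~` D)); last by rewrite setUv; exact: probability_setT.
rewrite measureU ?setICr//; last exact: measurableC.
by rewrite -[LHS]adde0; congr (_ + _); rewrite -[LHS]D0.
Qed.

Lemma integral_cst_prob d (T : measurableType d) (m : probability T R) (c : \bar R) :
  \int[m]_x cst c x = c.
Proof.
rewrite integral_cst//; transitivity (c * 1); last exact: mule1.
by congr (_ * _); exact: probability_setT.
Qed.

(** Invariance evaluates inner integrals only at unit quaternions, hence the conull sets [D1] and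
    [D2]. When [A] and [B] are constant, [integral_cst_prob] makes this an equality of two
    numbers. *)
Lemma fubini_conull (D1 : set T1) (D2 : set T2) (F : T1 * T2 -> \bar R)
    (A : T1 -> \bar R) (B : T2 -> \bar R) :
  measurable D1 -> m1 (~` D1) = 0 -> measurable D2 -> m2 (~` D2) = 0 ->
  measurable_fun setT F -> (forall z, 0 <= F z) ->
  measurable_fun setT A -> (forall x, 0 <= A x) ->
  measurable_fun setT B -> (forall y, 0 <= B y) ->
  (forall x, D1 x -> \int[m2]_y F (x, y) = A x) ->
  (forall y, D2 y -> \int[m1]_x F (x, y) = B y) ->
  \int[m1]_x A x = \int[m2]_y B y.
Proof.
move=> mD1 D10 mD2 D20 mF F0 mA A0 mB B0 FA FB.
rewrite -(@eq_integral_conull _ _ m1 _ (fun x => \int[m2]_y F (x, y)) A mD1 D10)//.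
- rewrite -(@eq_integral_conull _ _ m2 _ (fun y => \int[m1]_x F (x, y)) B mD2 D20)//.
  + exact: fubini_tonelli.
  + exact: measurable_fun_fubini_tonelli_G.
  + by move=> y; exact: integral_ge0.
- exact: measurable_fun_fubini_tonelli_F.
- by move=> x; exact: integral_ge0.
Qed.

End Fubini.

Section Haar.
Variable R : realType.
Variable nu : probability (quat R) R.
Hypothesis nuS : nu (~` @S3 R) = 0%E.
Hypothesis nuL : forall g, S3 g -> forall A, measurable A ->
  nu (qmul g @^-1` A) = nu A.
Local Open Scope ereal_scope.
Implicit Types (f : quat R -> \bar R) (g q : quat R).

Lemma measurable_S3 : measurable (@S3 R).
Proof.
rewrite -[X in measurable X]setTI; have := measurable_qsq (@measurable_id _ (quat R) setT).
by move=> /(_ measurableT [set 1%R]); apply; exact: measurable_set1.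
Qed.

Lemma integral_mulL f g : S3 g -> measurable_fun setT f -> (forall q, 0 <= f q) ->
  \int[nu]_q f (qmul g q) = \int[nu]_q f q.
Proof.
move=> hg mf f0.
have mg : measurable_fun setT (qmul g) by apply: measurable_qmul.
transitivity (\int[pushforward nu (qmul g)]_q f q).
  by rewrite ge0_integral_pushforward.
by apply: eq_measure_integral => A mA _; exact: nuL.
Qed.

(* Average [f (conj h * q)] over [h] and [q]: left invariance in [q] gives the
   integral of [f], left invariance in [h] that of [f (conj h)]. *)
Lemma integral_conj f : measurable_fun setT f -> (forall q, 0 <= f q) ->
  \int[nu]_q f (qconj q) = \int[nu]_q f q.
Proof.
move=> mf f0.
have S := measurable_S3.
have mc : measurable_fun setT (f \o @qconj R).
  by apply: measurableT_comp => //; exact: measurable_qconj.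
have cstE := integral_cst_prob nu.
rewrite -[LHS](cstE _) -[RHS](cstE _); apply/esym.
apply: (@fubini_conull _ _ _ _ R nu nu (@S3 R) (@S3 R)
  (fun z => f (qmul (qconj z.1) z.2))) => //.
- apply: measurableT_comp => //; apply: measurable_qmul => //.
  exact: measurable_qconj.
- by move=> ?; exact: integral_ge0.
- by move=> ?; exact: integral_ge0.
- by move=> h hh /=; rewrite integral_mulL//; exact: S3_conj.
- move=> q hq /=.
  rewrite -(integral_mulL (S3_conj hq) mc (fun q' => f0 (qconj q'))).
  by apply: eq_integral => h _ /=; rewrite qconjM qconjK.
Qed.

(** Conjugation preserves [nu] and reverses products, so it turns right translations into left
    ones. *)
Lemma integral_mulR f g : S3 g -> measurable_fun setT f -> (forall q, 0 <= f q) ->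
  \int[nu]_q f (qmul q g) = \int[nu]_q f q.
Proof.
move=> hg mf f0.
have mg : measurable_fun setT (fun q => f (qmul q g)).
  by apply: measurableT_comp => //; exact: measurable_qmul.
have mc : measurable_fun setT (f \o @qconj R).
  by apply: measurableT_comp => //; exact: measurable_qconj.
rewrite -(integral_conj mg)// -(integral_conj mf)//.
rewrite -(integral_mulL (S3_conj hg) mc (fun q => f0 (qconj q))).
by apply: eq_integral => h _ /=; rewrite qconjM qconjK.
Qed.

End Haar.

(** * Moments *)

Section PolyAux.
Variable R : realType.

Lemma poly_horner_inj (p q : {poly R}) : (forall t, p.[t] = q.[t]) -> p = q.
Proof.
move=> pq; apply/eqP; rewrite -subr_eq0; apply/negPn/negP => r0.
have := @max_poly_roots _ (p - q) [seq i%:R | i <- iota 0 (size (p - q))] r0.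
rewrite size_map size_iota ltnn => H; suff: false by []; apply: H.
  by apply/allP => x _; rewrite /root hornerD hornerN pq subrr.
by rewrite map_inj_uniq ?iota_uniq// => i j /eqP; rewrite eqr_nat => /eqP.
Qed.

Lemma coef_1DX2n n : ((1 + 'X^2) ^+ n : {poly R})`_0 = 1 /\
  ((1 + 'X^2) ^+ n : {poly R})`_2 = n%:R.
Proof.
elim: n => [|n [IH0 IH2]]; first by rewrite expr0 !coef1.
rewrite exprS mulrDl mul1r !coefD !coefXnM/= IH0 IH2 addr0.
by split => //; rewrite natr1.
Qed.

End PolyAux.

Section Moments.
Variable R : realType.
Variable nu : probability (quat R) R.
Hypothesis nuS : nu (~` @S3 R) = 0%E.
Hypothesis nuL : forall g, S3 g -> forall A, measurable A ->
  nu (qmul g @^-1` A) = nu A.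
Implicit Types (f W X Y T : quat R -> R) (g q : quat R).

(** Restricting to [S3] makes the coordinates bounded, so that all their monomials are
    integrable. *)
Definition mean f : R := \int[nu]_(q in @S3 R) f q.

Definition bounded1 f := measurable_fun setT f /\ forall q, S3 q -> `|f q| <= 1.

Let mS := @measurable_S3 R.

Lemma bounded1_integrable f : bounded1 f -> nu.-integrable (@S3 R) (EFin \o f).
Proof.
move=> [mf f1]; apply: measurable_bounded_integrable => //.
- apply: (le_lt_trans (probability_le1 nu mS)); exact: ltry.
- exact: measurable_funTS.
- by exists 1; split => // M M1 q hq; exact: le_trans (f1 q hq) (ltW M1).
Qed.

Lemma bounded1M f (f' : quat R -> R) : bounded1 f -> bounded1 f' -> bounded1 (fun q => f q * f' q).
Proof.
move=> [mf f1] [mg g1]; split; first exact: measurable_funM.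
by move=> q hq; rewrite normrM mulr_ile1 ?f1 ?g1.
Qed.

Lemma bounded1X f n : bounded1 f -> bounded1 (fun q => f q ^+ n).
Proof.
move=> [mf f1]; split; first exact: measurable_funX.
by move=> q hq; rewrite normrX exprn_ile1 ?f1.
Qed.

Lemma mean_sum m (f : nat -> quat R -> R) :
  (forall i, nu.-integrable (@S3 R) (EFin \o f i)) ->
  nu.-integrable (@S3 R) (EFin \o (fun q => \sum_(i < m) f i q)) /\
  mean (fun q => \sum_(i < m) f i q) = \sum_(i < m) mean (f i).
Proof.
move=> fi; elim: m => [|m [IH1 IH2]].
  rewrite big_ord0 (_ : (fun q => _) = cst 0); last first.
    by apply/funext => q; rewrite big_ord0.
  split; last by rewrite /mean Rintegral_cst// mul0r.
  exact: integrable0.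
rewrite big_ord_recr/= -IH2 (_ : (fun q => \sum_(i < m.+1) _) =
  (fun q => \sum_(i < m) f i q + f m q)); last first.
  by apply/funext => q; rewrite big_ord_recr.
split; last by rewrite /mean RintegralD.
exact: (integrableD mS IH1 (fi m)).
Qed.

Lemma mean_mulL f g : S3 g -> measurable_fun setT f -> (forall q, 0 <= f q) ->
  mean (fun q => f (qmul g q)) = mean f.
Proof.
move=> hg mf f0; rewrite /mean /Rintegral; congr fine.
have mF : measurable_fun setT (EFin \o f) by exact/measurable_EFinP.
have mg : measurable_fun setT (qmul g) by apply: measurable_qmul.
have F0 q : (0 <= (EFin \o f) q)%E by rewrite lee_fin.
rewrite (integral_conull mS nuS mF F0) -(integral_mulL nuL hg mF F0).
exact: (integral_conull mS nuS (measurableT_comp mF mg) (fun q => F0 (qmul g q))).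
Qed.

(* Both sides of [mean (W (X + tY)^(2n+2)) = (1 + t^2)^(n+1) mean (W X^(2n+2))]
   are polynomials in [t]; compare the coefficients of [t^2]. *)
Lemma rotation_moment W X Y n : bounded1 W -> bounded1 X -> bounded1 Y ->
  (forall c s, c ^+ 2 + s ^+ 2 = 1 ->
    mean (fun q => W q * (c * X q + s * Y q) ^+ n.+1.*2)
    = mean (fun q => W q * X q ^+ n.+1.*2)) ->
  mean (fun q => W q * (X q ^+ n.*2 * Y q ^+ 2)) * n.*2.+1%:R
  = mean (fun q => W q * X q ^+ n.+1.*2).
Proof.
move=> bW bX bY rot.
pose N := n.+1.*2.
pose a k := mean (fun q => W q * (X q ^+ (N - k) * Y q ^+ k)).
have bk k : nu.-integrable (@S3 R) (EFin \o (fun q => W q * (X q ^+ (N - k) * Y q ^+ k))).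
  by apply: bounded1_integrable; apply: bounded1M => //; apply: bounded1M; exact: bounded1X.
have a0 : a 0%N = mean (fun q => W q * X q ^+ N).
  by congr mean; apply/funext => q; rewrite subn0 expr0 mulr1.
pose P : {poly R} := \poly_(k < N.+1) ('C(N, k)%:R * a k).
pose Q : {poly R} := a 0%N *: (1 + 'X^2) ^+ n.+1.
have int_a t k : nu.-integrable (@S3 R)
    (EFin \o (fun q => ('C(N, k)%:R * t ^+ k) * (W q * (X q ^+ (N - k) * Y q ^+ k)))).
  exact: (integrableZl mS _ (bk k)).
have expand t : (fun q => \sum_(k < N.+1)
    ('C(N, k)%:R * t ^+ k) * (W q * (X q ^+ (N - k) * Y q ^+ k))) =
    (fun q => W q * (X q + t * Y q) ^+ N).
  apply/funext => q; rewrite exprDn mulr_sumr; apply: eq_bigr => k _.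
  by rewrite -mulr_natl exprMn; ring.
have int_exp t : nu.-integrable (@S3 R) (EFin \o (fun q => W q * (X q + t * Y q) ^+ N)).
  by rewrite -expand; exact: (mean_sum N.+1 (int_a t)).1.
have PE t : P.[t] = mean (fun q => W q * (X q + t * Y q) ^+ N).
  rewrite horner_poly -expand (mean_sum N.+1 (int_a t)).2.
  by apply: eq_bigr => k _; rewrite /mean RintegralZl// mulrAC.
have QE t : Q.[t] = mean (fun q => W q * (X q + t * Y q) ^+ N).
  rewrite /Q hornerZ horner_exp hornerD hornerXn hornerC a0.
  (* [(1, t)] is scaled to the point [(1/r, t/r)] of the unit circle; homogeneity of degree [N]
     gives back [r ^+ N], which is [(1 + t^2)^(n+1)]. *)
  pose r := Num.sqrt (1 + t ^+ 2).
  have r0 : 0 < 1 + t ^+ 2 by rewrite ltr_pwDl// sqr_ge0.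
  have rE : r ^+ 2 = 1 + t ^+ 2 by rewrite sqr_sqrtr// ltW.
  have r1 : r != 0 by rewrite gt_eqF// sqrtr_gt0.
  rewrite -(rot r^-1 (t / r)); last first.
    by rewrite expr_div_n exprVn rE -[X in X + _]mul1r -mulrDl divff// gt_eqF.
  rewrite -rE -exprM mul2n -/N.
  have -> : (fun q => W q * (r^-1 * X q + t / r * Y q) ^+ N) =
      (fun q => r ^- N * (W q * (X q + t * Y q) ^+ N)).
    apply/funext => q; rewrite [RHS]mulrCA -exprVn -exprMn.
    by congr (_ * _ ^+ _); rewrite mulrDr mulrA [_^-1 * t]mulrC.
  by rewrite /mean RintegralZl// mulrAC mulVf ?mul1r// expf_neq0.
have PQ : P = Q by apply: poly_horner_inj => t; rewrite PE QE.
(* The coefficients of [t^2] give [C(2n+2, 2) a_2 = (n+1) a_0], where the binomial is [(n+1)(2n+1)];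
   the factor [n+1] then cancels. *)
have := congr1 (fun p : {poly R} => p`_2) PQ.
rewrite /Q coefZ (coef_1DX2n R n.+1).2 coef_poly /N doubleS/=.
rewrite -/N bin2.
have -> : ((n.*2.+2 * n.*2.+2.-1)./2 = n.+1 * n.*2.+1)%N.
  by rewrite -doubleS -doubleMl doubleK.
rewrite natrM -a0 => h.
have -> : mean (fun q => W q * (X q ^+ n.*2 * Y q ^+ 2)) = a 2%N.
  by rewrite /a /N doubleS !subSS subn0.
move: (a 2%N) (a 0%N) h => x y h.
apply: (@mulfI _ n.+1%:R); first by rewrite pnatr_eq0.
by rewrite [RHS]mulrC -h; ring.
Qed.

Lemma mean_eq f (f' : quat R -> R) : (forall q, S3 q -> f q = f' q) -> mean f = mean f'.
Proof. by move=> ff'; apply: eq_Rintegral => q; rewrite inE => /ff'. Qed.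

Lemma mean1 : mean (fun=> 1) = 1.
Proof.
rewrite /mean Rintegral_cst// mul1r.
exact: (congr1 fine (probability_conull mS nuS)).
Qed.

Lemma measurable_qre : measurable_fun setT (@qre R).
Proof. by have [] := measurable_coords (@measurable_id _ (quat R) setT). Qed.
Lemma measurable_qi : measurable_fun setT (@qi R).
Proof. by have [] := measurable_coords (@measurable_id _ (quat R) setT). Qed.
Lemma measurable_qj : measurable_fun setT (@qj R).
Proof. by have [] := measurable_coords (@measurable_id _ (quat R) setT). Qed.
Lemma measurable_qk : measurable_fun setT (@qk R).
Proof. by have [] := measurable_coords (@measurable_id _ (quat R) setT). Qed.

Lemma bounded1_coords :
  [/\ bounded1 (@qre R), bounded1 (@qi R), bounded1 (@qj R) & bounded1 (@qk R)].
Proof.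
have sq (x y : R) : 0 <= y -> x ^+ 2 + y = 1 -> `|x| <= 1.
  move=> y0 h; rewrite -(@ler_pXn2r _ 2)// ?nnegrE// expr1n real_normK ?num_real//.
  by rewrite -h lerDl.
split; split; (try by [exact: measurable_qre|exact: measurable_qi|exact: measurable_qj|exact: measurable_qk]);
  move=> q; rewrite /S3 /qsq/= => h.
- by apply: (sq _ (qi q ^+ 2 + qj q ^+ 2 + qk q ^+ 2)); [rewrite !addr_ge0 ?sqr_ge0|rewrite -h; ring].
- by apply: (sq _ (qre q ^+ 2 + qj q ^+ 2 + qk q ^+ 2)); [rewrite !addr_ge0 ?sqr_ge0|rewrite -h; ring].
- by apply: (sq _ (qre q ^+ 2 + qi q ^+ 2 + qk q ^+ 2)); [rewrite !addr_ge0 ?sqr_ge0|rewrite -h; ring].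
- by apply: (sq _ (qre q ^+ 2 + qi q ^+ 2 + qj q ^+ 2)); [rewrite !addr_ge0 ?sqr_ge0|rewrite -h; ring].
Qed.

Lemma bounded1_1 : bounded1 (fun=> 1).
Proof. by split => // q _; rewrite normr1. Qed.

Lemma bounded1_cosq : bounded1 (@cosq R).
Proof.
split; first by apply: measurable_funD; apply: measurable_funX; [exact: measurable_qre|exact: measurable_qi].
move=> q; rewrite /S3/= => h; rewrite ger0_norm ?cosq_ge0// -h /cosq /qsq.
by rewrite -[leRHS]addrA lerDl addr_ge0 ?sqr_ge0.
Qed.

Let rotation_moment_left W X Y n (g : R -> R -> quat R) :
  bounded1 W -> bounded1 X -> bounded1 Y -> (forall q, 0 <= W q) ->
  (forall c s, c ^+ 2 + s ^+ 2 = 1 -> S3 (g c s)) ->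
  (forall c s q, c ^+ 2 + s ^+ 2 = 1 -> W (qmul (g c s) q) = W q /\
    X (qmul (g c s) q) = c * X q + s * Y q) ->
  mean (fun q => W q * (X q ^+ n.*2 * Y q ^+ 2)) * n.*2.+1%:R
  = mean (fun q => W q * X q ^+ n.+1.*2).
Proof.
move=> bW bX bY W0 gS gWX; apply: rotation_moment => // c s cs.
rewrite -[RHS](mean_mulL (gS _ _ cs)).
- by apply: mean_eq => q _; have [-> ->] := gWX c s q cs.
- by apply: measurable_funM; [exact: bW.1|apply: measurable_funX; exact: bX.1].
- by move=> q; rewrite mulr_ge0// exprn_even_ge0// odd_double.
Qed.

(** Left multiplication by [c - s i], and likewise for [j] and [k], mixes [qre] with one imaginary
    coordinate. Summing the three instances of [rotation_moment] over the sphere equation gives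
    [(2n+1)(M_n - M_(n+1)) = 3 M_(n+1)]. *)
Lemma mean_qre n : mean (fun q => qre q ^+ n.*2) = wz R n 1.
Proof.
have [bre bi bj bk] := bounded1_coords.
elim: n => [|n IH]; first by rewrite wz0; exact: mean1.
have step Y (g : R -> R -> quat R) : bounded1 Y ->
  (forall c s, c ^+ 2 + s ^+ 2 = 1 -> S3 (g c s)) ->
  (forall c s q, c ^+ 2 + s ^+ 2 = 1 -> qre (qmul (g c s) q) = c * qre q + s * Y q) ->
  mean (fun q => 1 * (qre q ^+ n.*2 * Y q ^+ 2)) * n.*2.+1%:R =
  mean (fun q => qre q ^+ n.+1.*2).
  move=> bY gS gX; rewrite (@rotation_moment_left _ _ _ _ g bounded1_1 bre bY)//.
    by apply: mean_eq => q _; rewrite mul1r.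
  by move=> c s q cs; split; rewrite ?gX.
have s1 := @step (@qi R) (fun c s => mkquat c (- s) 0 0) bi.
have s2 := @step (@qj R) (fun c s => mkquat c 0 (- s) 0) bj.
have s3 := @step (@qk R) (fun c s => mkquat c 0 0 (- s)) bk.
have {}s1 := s1 ltac:(by move=> c s; rewrite /S3 /qsq /mkquat /qre /qi /qj /qk/= => <-; ring)
  ltac:(by move=> c s q _; rewrite /qmul /mkquat /qre /qi /qj /qk/=; ring).
have {}s2 := s2 ltac:(by move=> c s; rewrite /S3 /qsq /mkquat /qre /qi /qj /qk/= => <-; ring)
  ltac:(by move=> c s q _; rewrite /qmul /mkquat /qre /qi /qj /qk/=; ring).
have {}s3 := s3 ltac:(by move=> c s; rewrite /S3 /qsq /mkquat /qre /qi /qj /qk/= => <-; ring)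
  ltac:(by move=> c s q _; rewrite /qmul /mkquat /qre /qi /qj /qk/=; ring).
have int Y : bounded1 Y -> nu.-integrable (@S3 R) (EFin \o (fun q => 1 * (qre q ^+ n.*2 * Y q ^+ 2))).
  move=> bY; apply: bounded1_integrable; apply: bounded1M; first exact: bounded1_1.
  by apply: bounded1M; exact: bounded1X.
have int2 m : nu.-integrable (@S3 R) (EFin \o (fun q => qre q ^+ m)).
  by apply: bounded1_integrable; exact: bounded1X.
have sum : mean (fun q => qre q ^+ n.*2) - mean (fun q => qre q ^+ n.+1.*2) =
  mean (fun q => 1 * (qre q ^+ n.*2 * qi q ^+ 2)) + mean (fun q => 1 * (qre q ^+ n.*2 * qj q ^+ 2))
   + mean (fun q => 1 * (qre q ^+ n.*2 * qk q ^+ 2)).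
  rewrite /mean -RintegralB// -RintegralD//; [|exact: int..].
  rewrite -RintegralD//; [|exact: (integrableD mS (int _ bi) (int _ bj))|exact: int].
  apply: eq_Rintegral => q; rewrite inE /S3/= => h.
  rewrite doubleS !exprS; have : qre q ^+ 2 = 1 - qi q ^+ 2 - qj q ^+ 2 - qk q ^+ 2.
    by rewrite -h /qsq; ring.
  by rewrite expr2 mulrA => ->; ring.
move: sum s1 s2 s3; rewrite IH wzS natr_double.
rewrite -[n.*2.+1]addn1 natrD natr_double add1n -[n.+2]addn2 natrD.
have n0 := ler0n R n.
set a := mean (fun q => 1 * (_ * qi q ^+ 2)); set b := mean (fun q => 1 * (_ * qj q ^+ 2)).
set c := mean (fun q => 1 * (_ * qk q ^+ 2)); set m := mean _; set w := wz R n 1.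
move: a b c m w => a b c m w sum s1 s2 s3.
have : (w - m) * (2 * n%:R + 1) = 3 * m.
  by rewrite sum (mulrDl (a + b)) (mulrDl a) s1 s2 s3; ring.
move=> h; apply: (@mulIf _ (2 * (n%:R + 2))); first by rewrite lt0r_neq0//; lra.
transitivity (w * (2 * n%:R + 1)); first lra.
by field; rewrite lt0r_neq0//; lra.
Qed.

(** The rotation by [c - s i] fixes [cosq], so powers of [cosq] can serve as the weight. Each step
    trades a factor [qre ^+ 2] for a factor [cosq], at the cost of [(2n+1)/(2n+2)]. *)
Lemma mean_cosq_qre n k :
  mean (fun q => cosq q ^+ k * qre q ^+ n.*2) = wz R n 0 * mean (fun q => cosq q ^+ (k + n)).
Proof.
have [bre bi _ _] := bounded1_coords.
have bc := bounded1_cosq.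
elim: n k => [|n IH] k.
  by rewrite wz0 mul1r addn0; apply: mean_eq => q _; rewrite expr0 mulr1.
have := @rotation_moment_left (fun q => cosq q ^+ k) (@qre R) (@qi R) n
  (fun c s => mkquat c (- s) 0 0) (bounded1X k bc) bre bi.
move=> /(_ (fun q => exprn_ge0 k (cosq_ge0 q))).
move=> /(_ ltac:(by move=> c s; rewrite /S3 /qsq /mkquat /qre /qi /qj /qk/= => <-; ring)).
move=> /(_ ltac:(by move=> c s q cs; split; [congr (_ ^+ k);
  rewrite -[RHS]mul1r -cs|]; rewrite /cosq /qmul /mkquat /qre /qi /qj /qk/=; ring)).
have -> : mean (fun q => cosq q ^+ k * (qre q ^+ n.*2 * qi q ^+ 2)) =
  mean (fun q => cosq q ^+ k.+1 * qre q ^+ n.*2) - mean (fun q => cosq q ^+ k * qre q ^+ n.+1.*2).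
  rewrite /mean -RintegralB//.
  - by apply: eq_Rintegral => q _; rewrite doubleS !exprS /cosq; ring.
  - by apply: bounded1_integrable; apply: bounded1M; exact: bounded1X.
  - by apply: bounded1_integrable; apply: bounded1M; exact: bounded1X.
rewrite IH wzS add0n addSnnS -[n.*2.+1]addn1 natrD !natr_double -[n.+1]addn1 natrD.
have n0 := ler0n R n.
set m := mean (fun q => _ * _); move: (mean _) (wz R n 0) => a w h.
apply: (@mulIf _ (2 * (n%:R + 1))); first by rewrite lt0r_neq0//; lra.
transitivity (w * a * (2 * n%:R + 1)); first lra.
by field; rewrite lt0r_neq0//; lra.
Qed.

(** The moment of [qre] of order [2n] is computed in two ways, by [mean_qre] and by [mean_cosq_qre]
    at [k = 0]; [wz_shift] gives the quotient. *)
Lemma mean_cosq n : mean (fun q => cosq q ^+ n) = n.+1%:R^-1.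
Proof.
have := mean_cosq_qre n 0; rewrite add0n.
have -> : mean (fun q => cosq q ^+ 0 * qre q ^+ n.*2) = wz R n 1.
  by rewrite -mean_qre; apply: mean_eq => q _; rewrite expr0 mul1r.
rewrite (_ : wz R n 1 = wz R n 0 * n.+1%:R^-1); last first.
  by rewrite -[LHS](mulfK (_ : n.+1%:R != 0)) ?pnatr_eq0// -[n.+1]add0n wz_shift mulr1.
move=> /mulfI <-//; rewrite gt_eqF// /wz; apply: prodr_gt0 => j _.
by rewrite divr_gt0 ?ltr0n.
Qed.

(** The terms of [mlog] are nonnegative, so they are integrated one by one; on [S3] the absolute
    value drops out and moments of [1 - T] remain. *)
Lemma integral_mlog T (m : nat -> R) (l : R) : measurable_fun setT T ->
  (forall q, S3 q -> 0 <= T q <= 1) ->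
  (forall n, mean (fun q => (1 - T q) ^+ n) = m n) ->
  (fun N => \sum_(0 <= n < N) m n.+1 / n.+1%:R) @ \oo --> l ->
  (\int[nu]_q mlog (T q) = l%:E)%E.
Proof.
move=> mT T01 mE cvl.
have m1T : measurable_fun setT (fun q => 1 - T q) by exact: measurable_funB.
have b1T : bounded1 (fun q => 1 - T q).
  by split => // q /T01/andP[? ?]; rewrite ler_norml; apply/andP; split; lra.
have mt n : measurable_fun setT (fun q => (`|1 - T q| ^+ n.+1 / n.+1%:R)%:E).
  apply/measurable_EFinP/measurable_funM => //; apply: measurable_funX.
  exact: measurableT_comp.
have t0 n q : (0 <= (`|1 - T q| ^+ n.+1 / n.+1%:R)%:E)%E by rewrite lee_fin divr_ge0.
rewrite -(integral_conull mS nuS); last 2 first.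
- exact: (measurableT_comp (@measurable_mlog R) mT).
- by move=> q; exact: mlog_ge0.
rewrite /mlog integral_nneseries//; last by move=> n; exact: measurable_funTS.
rewrite -(cvg_nneseries _ cvl); last first.
  move=> n; rewrite divr_ge0// -mE; apply: Rintegral_ge0 => q /T01/andP[_ ?].
  by rewrite exprn_ge0// subr_ge0.
congr (limn _); apply/funext => N; apply: eq_bigr => n _.
rewrite -mE mulrC -RintegralZl//; last by apply: bounded1_integrable; exact: bounded1X.
rewrite [RHS]fineK; last first.
  apply: integrable_fin_num => //.
  apply: (integrableZl mS (n.+1%:R^-1) (bounded1_integrable (bounded1X n.+1 b1T))).
apply: eq_integral => q; rewrite inE => /T01/andP[_ ?].
by rewrite ger0_norm ?subr_ge0// mulrC.
Qed.

Lemma integral_mlog_sinsq : (\int[nu]_q mlog (sinsq q) = (2 * ln 2 - 1)%:E)%E.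
Proof.
apply: (@integral_mlog _ (fun n => wz R n 1)).
- by repeat apply: measurable_funD; apply: measurable_funX;
    [exact: measurable_qi|exact: measurable_qj|exact: measurable_qk].
- by move=> q hq; rewrite sinsq_ge0 sinsq_le1.
- by move=> n; rewrite -mean_qre; apply: mean_eq => q /sinsqE ->; rewrite -exprM mul2n.
- exact: cvg_wzsum.
Qed.

(** Left multiplication by [j] swaps the planes of [1, i] and of [j, k], so [cosq] may be replaced
    by a function equal to [1 - cosq] on the sphere; the moments to sum are then those of [cosq]
    itself. *)
Lemma integral_mlog_cosq : (\int[nu]_q mlog (cosq q) = 1%:E)%E.
Proof.
have mc := bounded1_cosq.1.
have Sj : S3 (mkquat 0 0 1 0 : quat R).
  by rewrite /S3 /qsq /mkquat /qre /qi /qj /qk/= expr1n expr0n/= !addr0 add0r.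
have mF : measurable_fun setT (fun q : quat R => mlog (cosq q)).
  exact: (measurableT_comp (@measurable_mlog R) mc).
rewrite -(integral_mulL nuL Sj mF) => [|q]; last exact: mlog_ge0.
have E q : cosq (qmul (mkquat 0 0 1 0) q) = qj q ^+ 2 + qk q ^+ 2.
  by rewrite /cosq /qmul /mkquat /qre /qi /qj /qk/=; ring.
under eq_integral do rewrite E.
have E1 q : S3 q -> 1 - (qj q ^+ 2 + qk q ^+ 2) = cosq q.
  by rewrite /S3/= => <-; rewrite /qsq /cosq; ring.
apply: (@integral_mlog _ (fun n => n.+1%:R^-1)).
- by apply: measurable_funD; apply: measurable_funX; [exact: measurable_qj|exact: measurable_qk].
- move=> q hq; rewrite addr_ge0 ?sqr_ge0//= -subr_ge0 E1// cosq_ge0//.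
- by move=> n; rewrite -mean_cosq; apply: mean_eq => q /E1 ->.
- exact: cvg_sum_inv_mul.
Qed.

End Moments.

(** * Haar measure on the torus *)

Section Assembly.
Variable R : realType.
Variable nu : probability (quat R) R.
Hypothesis nuS : nu (~` @S3 R) = 0%E.
Hypothesis nuL : forall g, S3 g -> forall A, measurable A ->
  nu (qmul g @^-1` A) = nu A.
Local Open Scope ereal_scope.

Let mS := @measurable_S3 R.

Lemma measurable_mlogT d (T : measurableType d) (f : T -> R) :
  measurable_fun setT f -> measurable_fun setT (fun t => mlog (f t)).
Proof. exact: measurableT_comp (@measurable_mlog R). Qed.

Lemma measurable_linesq u : measurable_fun setT (@linesq R u).
Proof.
have [? ? ? ?] := measurable_coords (@measurable_id _ (quat R) setT).
apply: measurable_funD; apply: measurable_funX => //.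
by repeat apply: measurable_funD; apply: measurable_funM.
Qed.

Lemma integral_mlog_linesq u : sinsq u = 1%R ->
  \int[nu]_h mlog (linesq u h) = \int[nu]_h mlog (cosq h).
Proof.
move=> /axis_conj[k kS kE].
have m0 := measurable_mlogT (measurable_linesq u).
have m1 : measurable_fun setT (fun h => mlog (linesq u (qmul (qconj k) h))).
  apply: measurable_mlogT; apply: measurableT_comp; first exact: measurable_linesq.
  exact: measurable_qmul.
have p0 h : 0 <= mlog (linesq u h) by exact: mlog_ge0.
rewrite -(integral_mulL nuL (S3_conj kS) m0 p0).
rewrite -(integral_mulR nuS nuL kS m1 (fun h => p0 (qmul (qconj k) h))).
apply: (eq_integral_conull mS nuS).
- apply: (measurableT_comp m1); exact: measurable_qmul.
- exact: measurable_mlogT (bounded1_cosq R).1.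
- by move=> h; exact: mlog_ge0.
- by move=> h; exact: mlog_ge0.
- by move=> h hh /=; rewrite kE.
Qed.

(** The axis [u] is chosen for each [g] separately; it disappears because the integral over [h] is
    the same for every axis. *)
Lemma integral_mlog_mahler_arg_fiber g : S3 g ->
  \int[nu]_h mlog (mahler_arg (qmul h g) h) =
  mlog (sinsq g) + \int[nu]_h mlog (cosq h).
Proof.
move=> hg; have [u u1 gu] := axis_factor g.
rewrite -(integral_mlog_linesq u1).
have ml := measurable_mlogT (measurable_linesq u).
rewrite -[X in _ = X + _](integral_cst_prob nu).
rewrite -ge0_integralD//; last 2 first.
- by move=> h _; exact: mlog_ge0.
- by move=> h _; exact: mlog_ge0.
apply: (eq_integral_conull mS nuS).
- apply: measurable_mlogT; apply: measurable_mahler_arg => //.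
  exact: measurable_qmul.
- exact: emeasurable_funD.
- by move=> h; exact: mlog_ge0.
- by move=> h; rewrite adde_ge0 ?mlog_ge0.
- move=> h hh /=; rewrite mahler_arg_mul// gu mlogM//.
    by rewrite sinsq_ge0 sinsq_le1.
  by rewrite linesq_ge0 linesq_le1.
Qed.

Lemma integral_mlog_mahler_arg :
  \int[nu]_y \int[nu]_x mlog (mahler_arg x y) = (2 * ln 2)%:E.
Proof.
have mF : measurable_fun setT (fun z : quat R * quat R => mlog (mahler_arg z.1 z.2)).
  by apply: measurable_mlogT; apply: measurable_mahler_arg.
have mG : measurable_fun setT
    (fun z : quat R * quat R => mlog (mahler_arg (qmul z.2 z.1) z.2)).
  by apply: measurable_mlogT; apply: measurable_mahler_arg => //; exact: measurable_qmul.
have ms : measurable_fun setT (fun g : quat R => mlog (sinsq g)).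
  apply: measurable_mlogT; repeat apply: measurable_funD; apply: measurable_funX.
  - exact: measurable_qi.
  - exact: measurable_qj.
  - exact: measurable_qk.
have Ic := integral_mlog_cosq nuS nuL.
transitivity (\int[nu]_g (mlog (sinsq g) + \int[nu]_h mlog (cosq h))); last first.
  rewrite Ic ge0_integralD//.
  - rewrite (integral_mlog_sinsq nuS nuL) (integral_cst_prob nu) -EFinD.
    by congr (_%:E); ring.
  - by move=> g _; exact: mlog_ge0.
(* Integrating over [h] first gives the fiber formula; integrating over [g] first, left invariance
   undoes the substitution [x = h g]. *)
apply/esym; apply: (@fubini_conull _ _ _ _ R nu nu (@S3 R) (@S3 R) _ _ _
  mS nuS mS nuS mG).
- by move=> z; exact: mlog_ge0.
- by rewrite Ic; apply: emeasurable_funD.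
- by move=> g; rewrite Ic adde_ge0 ?mlog_ge0// lee_fin.
- exact: (@measurable_fun_fubini_tonelli_G _ _ _ _ _ nu _ mF (fun z => mlog_ge0 (mahler_arg z.1 z.2))).
- by move=> y; apply: integral_ge0 => x _; exact: mlog_ge0.
- by move=> g hg /=; exact: integral_mlog_mahler_arg_fiber.
- move=> h hh /=.
  apply: (integral_mulL nuL hh (f := fun x => mlog (mahler_arg x h))).
  + by apply: measurable_mlogT; apply: measurable_mahler_arg.
  + by move=> x; exact: mlog_ge0.
Qed.

End Assembly.

(** * The torus measure as a product of sphere measures *)

Section Torus.
Variable R : realType.
Variable mu : probability ((quat R * quat R)%type) R.
Hypothesis muH : is_Haar_torusH2 mu.
Local Open Scope ereal_scope.

Let mS := @measurable_S3 R.
Let q1 : quat R := mkquat 1 0 0 0.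

Lemma qmul1q q : qmul q1 q = q.
Proof.
by case: q => [[[a b] c] d]; rewrite /qmul /mkquat /qre /qi /qj /qk/=;
  congr (_, _, _, _); ring.
Qed.

Lemma S3_1 : S3 q1.
Proof. by rewrite /S3 /qsq /mkquat /qre /qi /qj /qk/= expr1n expr0n/= !addr0. Qed.

Lemma torusH2E : @torusH2 R = @S3 R `*` @S3 R.
Proof. by apply/seteqP; split => z [] /qnorm1 h1 /qnorm1 h2. Qed.

Lemma measurable_torusH2 : measurable (@torusH2 R).
Proof. by rewrite torusH2E; exact: measurableX. Qed.

Lemma torusH2C0 : mu (~` @torusH2 R) = 0.
Proof. exact: muH.1. Qed.

(** [nu] is the law of the first coordinate under [mu]; its invariance is that of [mu] under the
    translations [(g, 1)]. *)
Lemma marginal_Haar : exists nu : probability (quat R) R,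
  nu (~` @S3 R) = 0 /\ forall g, S3 g -> forall A, measurable A ->
    nu (qmul g @^-1` A) = nu A.
Proof.
have mf : @fst (quat R) (quat R) \in mfun by apply: mem_set; exact: measurable_fst.
exists (distribution mu (mfun_Sub mf)); split.
  apply: (@subset_measure0 _ _ _ mu _ (~` @torusH2 R)).
  - rewrite -[X in measurable X]setTI; apply: measurable_fst => //.
    exact: measurableC.
  - by apply: measurableC; exact: measurable_torusH2.
  - by rewrite torusH2E => z /= h [].
  - exact: torusH2C0.
move=> g hg A mA.
have := muH.2 (g, q1); rewrite torusH2E => /(_ (conj hg S3_1)).
move=> /(_ (fst @^-1` A)); apply.
by rewrite -[X in measurable X]setTI; exact: measurable_fst.
Qed.

Lemma integral_ltransl g F : torusH2 g -> measurable_fun setT F ->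
  (forall z, 0 <= F z) -> \int[mu]_z F (ltransl g z) = \int[mu]_z F z.
Proof.
move=> hg mF F0.
have mg : measurable_fun setT (ltransl g).
  by apply: measurable_fun_pair; apply: measurable_qmul.
transitivity (\int[pushforward mu (ltransl g)]_z F z).
  by rewrite ge0_integral_pushforward.
by apply: eq_measure_integral => A mA _; exact: muH.2.
Qed.

(* Averaging over left translates shows that [mu] is the product of any
   left-invariant probability on the unit sphere with itself. *)
Lemma integral_Haar_prod (nu : probability (quat R) R) F :
  nu (~` @S3 R) = 0 -> (forall g, S3 g -> forall A, measurable A ->
    nu (qmul g @^-1` A) = nu A) ->
  measurable_fun setT F -> (forall z, 0 <= F z) ->
  \int[mu]_z F z = \int[nu]_y \int[nu]_x F (x, y).
Proof.
move=> nuS nuL mF F0.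
have mT := measurable_torusH2; have T0 := torusH2C0.
pose G y := \int[nu]_x F (x, y).
have mG : measurable_fun setT G.
  exact: (@measurable_fun_fubini_tonelli_G _ _ _ _ _ nu _ mF F0).
have G0 y : 0 <= G y by exact: integral_ge0.
have mG2 : measurable_fun setT (fun z : quat R * quat R => G z.2).
  by apply: (measurableT_comp mG); exact: measurable_snd.
(* [F (g x, y)] is averaged over [g] and [(x, y)]: over [g] first, right invariance of [nu] gives
   [G y]; over [(x, y)] first, translation of [mu] by [(g, 1)] gives the integral of [F]. *)
transitivity (\int[mu]_z G z.2).
  rewrite -[LHS](integral_cst_prob nu); apply/esym.
  apply: (@fubini_conull _ _ _ _ R mu nu (@torusH2 R) (@S3 R)
    (fun w => F (qmul w.2 w.1.1, w.1.2)) _ _ mT T0 mS nuS) => //.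
  - apply: (measurableT_comp mF); apply: measurable_fun_pair.
      apply: measurable_qmul; first exact: measurable_snd.
      by apply: measurableT_comp; [exact: measurable_fst|exact: measurable_fst].
    by apply: measurableT_comp; [exact: measurable_snd|exact: measurable_fst].
  - by move=> g; exact: integral_ge0.
  - move=> [x y]; rewrite torusH2E => -[/= hx hy].
    apply: (integral_mulR nuS nuL hx (f := fun g => F (g, y))) => //.
    by apply: (measurableT_comp mF); exact: measurable_pair2.
  - move=> g hg /=.
    rewrite -[RHS](@integral_ltransl (g, q1))//.
      by apply: eq_integral => z _; rewrite /ltransl/= qmul1q.
    by rewrite torusH2E; split => //; exact: S3_1.
(* The same averaging in the second coordinate, now of [G (h y)]; both inner integrals are
   constants. *)
rewrite -[RHS](integral_cst_prob mu).
apply/esym; transitivity (\int[nu]_h (\int[mu]_z G z.2)); last first.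
  exact: integral_cst_prob.
apply: (@fubini_conull _ _ _ _ R mu nu (@torusH2 R) (@S3 R)
    (fun w => G (qmul w.2 w.1.2)) _ _ mT T0 mS nuS) => //.
- apply: (measurableT_comp mG); apply: measurable_qmul; first exact: measurable_snd.
  by apply: measurableT_comp; [exact: measurable_snd|exact: measurable_fst].
- by move=> z; apply: integral_ge0 => y _; exact: G0.
- by move=> h; apply: integral_ge0 => z _; exact: G0.
- move=> [x y]; rewrite torusH2E => -[/= hx hy].
  exact: (integral_mulR nuS nuL hy mG G0).
- move=> h hh /=.
  rewrite -(@integral_ltransl (q1, h) (fun z => G z.2))//.
  by rewrite torusH2E; split => //; exact: S3_1.
Qed.

Lemma integral_mlog_torusH2 :
  \int[mu]_(z in @torusH2 R) mlog (mahler_arg z.1 z.2) = (2 * ln 2)%:E.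
Proof.
have [nu [nuS nuL]] := marginal_Haar.
have mF : measurable_fun setT (fun z : quat R * quat R => mlog (mahler_arg z.1 z.2)).
  by apply: measurable_mlogT; apply: measurable_mahler_arg;
    [exact: measurable_fst|exact: measurable_snd].
rewrite (integral_conull measurable_torusH2 torusH2C0 mF (fun z => mlog_ge0 _)).
rewrite (integral_Haar_prod nuS nuL mF (fun z => mlog_ge0 _)).
exact: integral_mlog_mahler_arg.
Qed.

End Torus.

(** * Return from [mlog] to [ln] *)

Lemma ln_half (R : realType) (a b : R) : 0 < a -> 0 < b -> a ^+ 2 = 4 * b ->
  ln a = ln 2 - 2^-1 * - ln b.
Proof.
move=> a0 b0 ab.
have : ln (a * a) = ln (2 * (2 * b)) by congr ln; rewrite -expr2 ab; ring.
rewrite !lnM ?posrE ?mulr_gt0// => ?; lra.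
Qed.

Theorem theorem7p2 (R : realType) (mu : probability ((quat R * quat R)%type) R) :
  is_Haar_torusH2 mu ->
  mahlerH mu (fun x y => qsub (qmul x x) (qmul y y)) = 0%E.
Proof.
move=> muH; rewrite /mahlerH.
have mT := @measurable_torusH2 R.
have mV : measurable_fun setT (fun z : quat R * quat R => mahler_arg z.1 z.2).
  by apply: measurable_mahler_arg; [exact: measurable_fst|exact: measurable_snd].
have mL : measurable_fun (@torusH2 R)
    (fun z : quat R * quat R => mlog (mahler_arg z.1 z.2)).
  by apply: measurable_funTS; exact: measurable_mlogT.
have I := integral_mlog_torusH2 muH.
have iL : mu.-integrable (@torusH2 R) (fun z => mlog (mahler_arg z.1 z.2)).
  apply/integrableP; split => //.
  under eq_integral do rewrite gee0_abs ?mlog_ge0//.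
  by rewrite I ltry.
have iL2 : mu.-integrable (@torusH2 R) (fun z => (2^-1)%:E * mlog (mahler_arg z.1 z.2))%E.
  exact: integrableZl.
have ic : mu.-integrable (@torusH2 R) (cst (ln 2 : R)%:E).
  exact: finite_measure_integrable_cst.
transitivity (\int[mu]_(z in @torusH2 R)
    ((ln 2)%:E - (2^-1)%:E * mlog (mahler_arg z.1 z.2)))%E; last first.
  rewrite integralB// integralZl// I.
  have -> : (\int[mu]_(z in @torusH2 R) (ln 2)%:E = (ln 2 : R)%:E)%E.
    rewrite integral_cst// -[RHS]mule1; congr (_ * _)%E.
    exact: probability_conull mT (torusH2C0 muH).
  by rewrite -EFinM -EFinB; congr (_%:E); field.
apply: ae_eq_integral => //.
- apply: measurable_funTS; apply/measurable_EFinP.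
  apply: measurableT_comp; first exact: measurable_ln.
  apply: (@measurableT_comp _ _ _ _ _ _ (@Num.sqrt R)).
    by apply: continuous_measurable_fun; exact: sqrt_continuous.
  by apply: measurable_qsq; apply: measurable_qsub; apply: measurable_qmul;
    [exact: measurable_fst|exact: measurable_fst|exact: measurable_snd|exact: measurable_snd].
- by apply: emeasurable_funB => //; exact: (measurable_int mu).
(* Where [x^2 = y^2] the two integrands differ, [ln 0] being 0 by convention and [mlog 0] being
   [+oo]; integrability of [mlog] makes this set null. *)
have [N [mN N0 sN]] := integrable_ae mT iL.
exists N; split => // z /= hz; apply: sN => /= h; apply: hz => Tz.
have {}h := h Tz; move: Tz; rewrite torusH2E => -[/= h1 h2].
set v := mahler_arg z.1 z.2 in h *.
have v0 : 0 < v.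
  rewrite lt_def mahler_arg_ge0 andbT; apply/eqP => v0.
  by move: h; rewrite v0 mlog0.
have q4 : qnorm (qsub (qmul z.1 z.1) (qmul z.2 z.2)) ^+ 2 = 4 * v.
  by rewrite qnorm_sq /v /mahler_arg; field.
set q := qnorm _ in q4 *.
have q0 : 0 < q.
  by rewrite lt_def sqrtr_ge0 andbT -sqrf_eq0 q4 gt_eqF// mulr_gt0.
rewrite mlogE ?v0 ?mahler_arg_le1// -EFinM -EFinB; congr (_%:E).
exact: ln_half.
Qed.
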